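(* Let $\mathcal{D}$ be a $k$-linear triangulated category. For any non-zero object $E$ of $\mathcal{D}$, the functions (1) $(t,\sigma)\mapsto m^t_\sigma(E)$, and (2) $(t,\sigma)\mapsto\phi^t_\sigma(E)$ define continuous maps $\mathbf{R}\times\mathrm{Stab}(\mathcal{D})\to\mathbf{R}$.
   Context: $k$ is a field. A pre-stability condition $\sigma=(Z,\mathcal{P})$ on $\mathcal{D}$ consists of a group homomorphism $Z:K_0(\mathcal{D})\to\mathbf{C}$ and a slicing, i.e. a collection $\mathcal{P}=\{\mathcal{P}(\phi)\}_{\phi\in\mathbf{R}}$ of full additive subcategories of $\mathcal{D}$, such that: (a) $\mathrm{Hom}(\mathcal{P}(\phi),\mathcal{P}(\psi))=0$ if $\phi>\psi$; (b) $\mathcal{P}(\phi)[1]=\mathcal{P}(\phi+1)$; (c) every non-zero object $E$ has a Harder--Narasimhan (HN) filtration $0=E_0\to E_1\to\cdots\to E_n=E$ whose successive cones $G_i$ (the HN factors, unique up to isomorphism) are non-zero objects of $\mathcal{P}(\phi_i)$ with $\phi_1>\cdots>\phi_n$; (d) $Z(E)\in\mathbf{R}_{>0}e^{i\pi\phi}$ for every non-zero $E\in\mathcal{P}(\phi)$. It is a stability condition if moreover each $\mathcal{P}(\phi)$ is a finite length abelian category. $\mathrm{Stab}(\mathcal{D})$ is the set of stability conditions. For a non-zero $E$ with HN factors $G_i\in\mathcal{P}(\phi_i)$, $i=1,\dots,n$: $\phi^+_\sigma(E)=\phi_1$, $\phi^-_\sigma(E)=\phi_n$; the $t$-deformed mass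 is $m^t_\sigma(E)=\sum_i|Z(G_i)|e^{t\phi_i}$ and $m_\sigma(E)=m^0_\sigma(E)$; the $t$-deformed phase is $\phi^0_\sigma(E)=\frac{1}{m_\sigma(E)}\sum_i|Z(G_i)|\phi_i$ for $t=0$ and $\phi^t_\sigma(E)=\frac1t\log\left(\frac{m^t_\sigma(E)}{m_\sigma(E)}\right)$ for $t\neq0$. $\mathrm{Stab}(\mathcal{D})$ carries the topology of the generalized metric \[ d(\sigma,\tau)=\sup_{0\ne E\in\mathcal{D}}\left\{|\phi^+_\sigma(E)-\phi^+_\tau(E)|,\ |\phi^-_\sigma(E)-\phi^-_\tau(E)|,\ \left|\log\tfrac{m_\tau(E)}{m_\sigma(E)}\right|\right\}. \] *)

(* Defs.v *)
From HB Require Import structures.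
From mathcomp Require Import all_boot all_order all_algebra ring_quotient.
From mathcomp Require Import freeg complex.
From mathcomp Require Import all_classical all_reals all_analysis.
Set Implicit Arguments.
Unset Strict Implicit.
Unset Printing Implicit Defensive.
Import Order.TTheory GRing.Theory Num.Theory.
Import numFieldNormedType.Exports.
Local Open Scope classical_set_scope.
Local Open Scope ring_scope.
Local Open Scope quotient_scope.

(* [compm g f] is g after f. *)
Record linearCategory (k : fieldType) := LinearCategory {
  ob :> Type;
  hom : ob -> ob -> lmodType k;
  idm : forall A, hom A A;
  compm : forall A B C, hom B C -> hom A B -> hom A C;
  comp1m : forall A B (f : hom A B), compm (idm B) f = f;
  compm1 : forall A B (f : hom A B), compm f (idm A) = f;
  compA : forall A B C E (h : hom C E) (g : hom B C) (f : hom A B),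
    compm h (compm g f) = compm (compm h g) f;
  comp_linearl : forall A B C (f : hom A B), linear (fun g : hom B C => compm g f);
  comp_linearr : forall A B C (g : hom B C), linear (fun f : hom A B => compm g f)
}.
Arguments hom {k l} A B.
Arguments idm {k l} A.
Arguments compm {k l A B C} g f.

Reserved Notation "g ∘ f" (at level 40, left associativity).
Declare Scope lincat_scope.
Delimit Scope lincat_scope with lincat.
Notation "g ∘ f" := (compm g f) : lincat_scope.
Local Open Scope lincat_scope.

Section LinearCategoryTheory.
Context {k : fieldType} {C : linearCategory k}.
Implicit Types A B K Q S X : C.

Definition is_iso A B (f : hom A B) : Prop :=
  exists g : hom B A, g ∘ f = idm A /\ f ∘ g = idm B.

Definition isomorphic A B : Prop := exists f : hom A B, is_iso f.

Definition is_zero A : Prop :=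
  forall B, (forall f : hom A B, f = 0) /\ (forall f : hom B A, f = 0).

Definition is_biproduct A B S (i1 : hom A S) (i2 : hom B S)
    (p1 : hom S A) (p2 : hom S B) : Prop :=
  [/\ p1 ∘ i1 = idm A, p2 ∘ i2 = idm B, p2 ∘ i1 = 0, p1 ∘ i2 = 0
    & i1 ∘ p1 + i2 ∘ p2 = idm S].

Definition monic A B (f : hom A B) : Prop :=
  forall X (g h : hom X A), f ∘ g = f ∘ h -> g = h.

Definition epic A B (f : hom A B) : Prop :=
  forall X (g h : hom B X), g ∘ f = h ∘ f -> g = h.

Definition is_kernel A B K (f : hom A B) (i : hom K A) : Prop :=
  f ∘ i = 0 /\
  forall X (g : hom X A), f ∘ g = 0 -> exists! u : hom X K, i ∘ u = g.

Definition is_cokernel A B Q (f : hom A B) (q : hom B Q) : Prop :=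
  q ∘ f = 0 /\
  forall X (g : hom B X), g ∘ f = 0 -> exists! u : hom Q X, u ∘ q = g.

Definition short_exact A B Q (i : hom A B) (q : hom B Q) : Prop :=
  is_kernel q i /\ is_cokernel i q.

Definition simple_object S : Prop :=
  ~ is_zero S /\ forall A (i : hom A S), monic i -> is_zero A \/ is_iso i.

(* [A] admits a finite composition series. *)
Inductive finite_length : C -> Prop :=
| finite_length0 A : is_zero A -> finite_length A
| finite_length_ext A B S (i : hom A B) (q : hom B S) :
    finite_length A -> simple_object S -> short_exact i q -> finite_length B.

End LinearCategoryTheory.

Definition additive_category {k : fieldType} (C : linearCategory k) : Prop :=
  (exists O : C, is_zero O) /\
  forall A B : C, exists (S : C) (i1 : hom A S) (i2 : hom B S)
    (p1 : hom S A) (p2 : hom S B), is_biproduct i1 i2 p1 p2.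

Definition abelian_category {k : fieldType} (C : linearCategory k) : Prop :=
  [/\ additive_category C,
      forall (A B : C) (f : hom A B), exists (K : C) (i : hom K A), is_kernel f i,
      forall (A B : C) (f : hom A B), exists (Q : C) (q : hom B Q), is_cokernel f q,
      forall (A B : C) (f : hom A B), monic f ->
        exists (Q : C) (g : hom B Q), is_kernel g f
    & forall (A B : C) (f : hom A B), epic f ->
        exists (K : C) (g : hom K A), is_cokernel g f].

Definition finite_length_abelian {k : fieldType} (C : linearCategory k) : Prop :=
  abelian_category C /\ forall A : C, finite_length A.

Section FullSubcategory.
Context {k : fieldType} {C : linearCategory k} (P : C -> Prop).

Definition full_subcategory : linearCategory k :=
  @LinearCategory k {A : C | P A}
    (fun A B => hom (sval A) (sval B))
    (fun A => idm (sval A))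
    (fun _ _ _ g f => g ∘ f)
    (fun _ _ f => comp1m f)
    (fun _ _ f => compm1 f)
    (fun _ _ _ _ h g f => compA h g f)
    (fun _ _ _ f => @comp_linearl _ C _ _ _ f)
    (fun _ _ _ g => @comp_linearr _ C _ _ _ g).

End FullSubcategory.

Record linearFunctor {k : fieldType} (C D : linearCategory k) := LinearFunctor {
  fob :> C -> D;
  fmap : forall A B : C, hom A B -> hom (fob A) (fob B);
  fmap1 : forall A : C, fmap (idm A) = idm (fob A);
  fmap_comp : forall (A B E : C) (g : hom B E) (f : hom A B),
    fmap (g ∘ f) = fmap g ∘ fmap f;
  fmap_linear : forall A B : C, linear (@fmap A B)
}.
Arguments fmap {k C D} F {A B} f : rename.

Section FunctorConstructions.
Context {k : fieldType}.

Definition id_functor (C : linearCategory k) : linearFunctor C C :=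
  @LinearFunctor k C C id (fun _ _ f => f) (fun _ => erefl) (fun _ _ _ _ _ => erefl)
    (fun _ _ _ _ _ => erefl).

Context {C D E : linearCategory k} (G : linearFunctor D E) (F : linearFunctor C D).

Let comp_fmap (A B : C) (f : hom A B) : hom (G (F A)) (G (F B)) := fmap G (fmap F f).

Let comp_fmap1 (A : C) : comp_fmap (idm A) = idm (G (F A)).
Proof. by rewrite /comp_fmap !fmap1. Qed.

Let comp_fmap_comp (A B B' : C) (g : hom B B') (f : hom A B) :
  comp_fmap (g ∘ f) = comp_fmap g ∘ comp_fmap f.
Proof. by rewrite /comp_fmap !fmap_comp. Qed.

Let comp_fmap_linear (A B : C) : linear (@comp_fmap A B).
Proof. by move=> a f g; rewrite /comp_fmap !fmap_linear. Qed.

Definition comp_functor : linearFunctor C E :=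
  LinearFunctor comp_fmap1 comp_fmap_comp comp_fmap_linear.

End FunctorConstructions.

Definition naturally_isomorphic {k : fieldType} {C D : linearCategory k}
    (F G : linearFunctor C D) : Prop :=
  exists eta : forall A : C, hom (F A) (G A),
    (forall (A B : C) (f : hom A B), eta B ∘ fmap F f = fmap G f ∘ eta A) /\
    (forall A : C, is_iso (eta A)).

Definition equivalence_of_categories {k : fieldType} {C D : linearCategory k}
    (F : linearFunctor C D) : Prop :=
  exists G : linearFunctor D C,
    naturally_isomorphic (comp_functor G F) (id_functor C) /\
    naturally_isomorphic (comp_functor F G) (id_functor D).

(* [distinguished f g h] says that X -f-> Y -g-> Z -h-> X[1] is distinguished.  The
   axioms are Verdier's (TR1)-(TR4). *)
Record triangulatedCategory (k : fieldType) := TriangulatedCategory {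
  tcat :> linearCategory k;
  tcat_additive : additive_category tcat;
  tshift : linearFunctor tcat tcat;
  shift_equivalence : equivalence_of_categories tshift;
  distinguished : forall X Y Z : tcat, hom X Y -> hom Y Z -> hom Z (tshift X) -> Prop;
  TR1_iso : forall (X Y Z X' Y' Z' : tcat)
      (f : hom X Y) (g : hom Y Z) (h : hom Z (tshift X))
      (f' : hom X' Y') (g' : hom Y' Z') (h' : hom Z' (tshift X'))
      (a : hom X X') (b : hom Y Y') (c : hom Z Z'),
    is_iso a -> is_iso b -> is_iso c ->
    b ∘ f = f' ∘ a -> c ∘ g = g' ∘ b -> fmap tshift a ∘ h = h' ∘ c ->
    distinguished f g h -> distinguished f' g' h';
  TR1_id : forall X O : tcat, is_zero O ->
    distinguished (idm X) (0 : hom X O) (0 : hom O (tshift X));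
  TR1_cone : forall (X Y : tcat) (f : hom X Y),
    exists (Z : tcat) (g : hom Y Z) (h : hom Z (tshift X)), distinguished f g h;
  TR2 : forall (X Y Z : tcat)
      (f : hom X Y) (g : hom Y Z) (h : hom Z (tshift X)),
    distinguished f g h <-> distinguished g h (- fmap tshift f);
  TR3 : forall (X Y Z X' Y' Z' : tcat)
      (f : hom X Y) (g : hom Y Z) (h : hom Z (tshift X))
      (f' : hom X' Y') (g' : hom Y' Z') (h' : hom Z' (tshift X'))
      (a : hom X X') (b : hom Y Y'),
    distinguished f g h -> distinguished f' g' h' -> b ∘ f = f' ∘ a ->
    exists c : hom Z Z', c ∘ g = g' ∘ b /\ fmap tshift a ∘ h = h' ∘ c;
  TR4 : forall (X Y Z U V W : tcat) (f : hom X Y) (g : hom Y Z)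
      (j : hom Y U) (d : hom U (tshift X))
      (l : hom Z V) (e : hom V (tshift X))
      (m : hom Z W) (n : hom W (tshift Y)),
    distinguished f j d -> distinguished (g ∘ f) l e -> distinguished g m n ->
    exists (u : hom U V) (v : hom V W),
      [/\ distinguished u v (fmap tshift j ∘ n),
          u ∘ j = l ∘ g, e ∘ u = d, v ∘ l = m & n ∘ v = fmap tshift f ∘ e]
}.
Arguments tshift {k t}.
Arguments distinguished {k t X Y Z} f g h.

Definition triangle {k : fieldType} {D : triangulatedCategory k} (X Y Z : D) : Prop :=
  exists (f : hom X Y) (g : hom Y Z) (h : hom Z (tshift X)), distinguished f g h.

Section GrothendieckGroup.
Context {k : fieldType} (D : triangulatedCategory k).

Definition free_ob : zmodType := {freeg {classic D}}.

Definition free_class (X : D) : free_ob := << (X : {classic D}) >>.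

Inductive K0_relation : free_ob -> Prop :=
| K0_relation_triangle X Y Z : triangle X Y Z ->
    K0_relation (free_class Y - free_class X - free_class Z)
| K0_relation0 : K0_relation 0
| K0_relationB x y : K0_relation x -> K0_relation y -> K0_relation (x - y).

Definition K0_relations : {pred free_ob} := fun x => `[< K0_relation x >].

Lemma K0_relations_zmod_closed : zmod_closed K0_relations.
Proof.
split=> [|x y /asboolP xR /asboolP yR]; apply/asboolP; first exact: K0_relation0.
exact: K0_relationB.
Qed.

HB.instance Definition _ :=
  GRing.isZmodClosed.Build free_ob K0_relations K0_relations_zmod_closed.

Definition K0 : zmodType := @Quotient.quot free_ob K0_relations.

Definition K0_class (X : D) : K0 := \pi_K0 (free_class X).

Lemma K0_class_triangle X Y Z : triangle X Y Z -> K0_class Y = K0_class X + K0_class Z.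
Proof.
move=> XYZ; rewrite -[RHS](@raddfD _ _ \pi_(@Quotient.quot free_ob K0_relations)).
apply/eqP; rewrite -Quotient.idealrBE opprD addrA; apply/asboolP.
exact: K0_relation_triangle.
Qed.

End GrothendieckGroup.

Section HarderNarasimhan.
Context {R : realType} {k : fieldType} {D : triangulatedCategory k}.

(* Only the values [hn_ob i] for [i <= n], and [hn_factor i], [hn_phase i] for
   [i < n], are meaningful; the i-th step of the filtration is the triangle
   E_i -> E_{i+1} -> G_i -> E_i[1], so that factors are numbered from 0. *)
Record HN_filtration (P : R -> D -> Prop) (E : D) := HNFiltration {
  hn_length : nat;
  hn_ob : nat -> D;
  hn_factor : nat -> D;
  hn_phase : nat -> R;
  hn_ob0 : is_zero (hn_ob 0);
  hn_obn : hn_ob hn_length = E;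
  hn_triangle : forall i, (i < hn_length)%N ->
    triangle (hn_ob i) (hn_ob i.+1) (hn_factor i);
  hn_factor_neq0 : forall i, (i < hn_length)%N -> ~ is_zero (hn_factor i);
  hn_factorP : forall i, (i < hn_length)%N -> P (hn_phase i) (hn_factor i);
  hn_phase_decr : forall i j, (i < j < hn_length)%N -> hn_phase j < hn_phase i
}.

End HarderNarasimhan.

(* The full subcategories P(phi) are given by their objects and are taken to be
   closed under isomorphism.  Likewise P(phi)[1] = P(phi + 1) is an equality of
   isomorphism-closed subcategories. *)
Record slicing (R : realType) (k : fieldType) (D : triangulatedCategory k) := Slicing {
  slice :> R -> D -> Prop;
  slice_iso : forall phi (A B : D), isomorphic A B -> slice phi A -> slice phi B;
  slice_additive : forall phi, additive_category (full_subcategory (slice phi));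
  slice_hom0 : forall phi psi (A B : D), psi < phi -> slice phi A -> slice psi B ->
    forall f : hom A B, f = 0;
  slice_shift : forall phi (B : D),
    slice (phi + 1) B <-> exists A : D, slice phi A /\ isomorphic (tshift A) B;
  slice_HN : forall E : D, ~ is_zero E -> inhabited (HN_filtration slice E)
}.

Record preStability (R : realType) (k : fieldType) (D : triangulatedCategory k) :=
  PreStability {
  central_charge : {additive K0 D -> R[i]};
  pslicing :> slicing R D;
  charge_slice : forall phi (E : D), pslicing phi E -> ~ is_zero E ->
    exists2 r : R, 0 < r &
      central_charge (K0_class E) = Complex (r * cos (pi * phi)) (r * sin (pi * phi))
}.

Record Stab (R : realType) (k : fieldType) (D : triangulatedCategory k) := Stability {
  prestab :> preStability R D;
  stab_finite_length : forall phi, finite_length_abelian (full_subcategory (prestab phi))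
}.

Section Mass.
Context {R : realType} {k : fieldType} {D : triangulatedCategory k}.
Implicit Types (s : Stab R D) (E : D) (t : R).

(* HN factors are unique up to isomorphism, so that the quantities below do not
   depend on the chosen filtration. *)
Definition HN s E (E0 : ~ is_zero E) : HN_filtration s E :=
  inhabited_witness (slice_HN s E0).

Definition phase_max s E (E0 : ~ is_zero E) : R := hn_phase (HN s E0) 0.

Definition phase_min s E (E0 : ~ is_zero E) : R :=
  hn_phase (HN s E0) (hn_length (HN s E0)).-1.

Definition factor_mass s E (E0 : ~ is_zero E) (i : nat) : R :=
  Normc.normc (central_charge s (K0_class (hn_factor (HN s E0) i))).

Definition tmass t s E (E0 : ~ is_zero E) : R :=
  \sum_(i < hn_length (HN s E0)) factor_mass s E0 i * expR (t * hn_phase (HN s E0) i).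

Definition mass s E (E0 : ~ is_zero E) : R := tmass 0 s E0.

Definition tphase t s E (E0 : ~ is_zero E) : R :=
  if t == 0 then
    (mass s E0)^-1 *
      \sum_(i < hn_length (HN s E0)) factor_mass s E0 i * hn_phase (HN s E0) i
  else t^-1 * ln (tmass t s E0 / mass s E0).

Definition stab_dist (s s' : Stab R D) : \bar R :=
  ereal_sup [set x | exists E (E0 : ~ is_zero E),
    [\/ x = `|phase_max s E0 - phase_max s' E0|%:E,
        x = `|phase_min s E0 - phase_min s' E0|%:E
      | x = `|ln (mass s' E0 / mass s E0)|%:E]].

Lemma mass_gt0 s E (E0 : ~ is_zero E) : 0 < mass s E0.
Proof.
rewrite /mass /tmass; have := @charge_slice _ _ _ s.
rewrite /factor_mass; case: (HN s E0) => n ob G phi /= ob0 obn _ Gn0 GP _ sP.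
have n_gt0 : (0 < n)%N.
  by rewrite lt0n; apply/eqP => n0; apply: E0; rewrite -obn n0.
have pos i : (i < n)%N -> 0 < Normc.normc (central_charge s (K0_class (G i))).
  move=> lin; have [r r0 ->] := sP _ _ (GP _ lin) (Gn0 _ lin).
  rewrite /Normc.normc sqrtr_gt0 !exprMn -mulrDr cos2Dsin2 mulr1.
  by rewrite exprn_gt0.
rewrite (bigD1 (Ordinal n_gt0)) //= ltr_pwDl//.
  by rewrite mulr_gt0 ?pos// expR_gt0.
by apply: sumr_ge0 => i _; rewrite mulr_ge0 ?expR_ge0// ltW// pos.
Qed.

Definition stab_ball (s : Stab R D) (e : R) (s' : Stab R D) : Prop :=
  (stab_dist s s' < e%:E)%E.

Let stab_ball_center s (e : R) : 0 < e -> stab_ball s e s.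
Proof.
move=> e0; rewrite /stab_ball; apply: (@le_lt_trans _ _ 0%E); last by rewrite lte_fin.
apply: ge_ereal_sup => _ [E [E0 []->]]; rewrite lee_fin.
- by rewrite subrr normr0.
- by rewrite subrr normr0.
- by rewrite divff ?gt_eqF ?mass_gt0// ln1 normr0.
Qed.

Let stab_ball_sym s s' (e : R) : stab_ball s e s' -> stab_ball s' e s.
Proof.
rewrite /stab_ball /stab_dist; congr (ereal_sup _ < _)%E; apply/funext => x.
apply/propext; split=> -[E [E0 xE]]; exists E, E0; move: xE.
all: rewrite (distrC (phase_max s E0)) (distrC (phase_min s E0)).
all: by rewrite -[mass s' E0 / _]invf_div lnV ?normrN// posrE divr_gt0 ?mass_gt0.
Qed.

Let stab_ball_triangle s s' s'' (e e' : R) :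
  stab_ball s e s' -> stab_ball s' e' s'' -> stab_ball s (e + e') s''.
Proof.
rewrite /stab_ball => d1 d2; rewrite EFinD.
apply: (le_lt_trans _ (lteD d1 d2)).
apply: ge_ereal_sup => _ [E [E0 []->]].
- apply: (@le_trans _ _ (`|phase_max s E0 - phase_max s' E0|%:E +
    `|phase_max s' E0 - phase_max s'' E0|%:E)%E).
    by rewrite -EFinD lee_fin ler_distD.
  by apply: leeD; apply: ereal_sup_ubound; exists E, E0; apply: Or31.
- apply: (@le_trans _ _ (`|phase_min s E0 - phase_min s' E0|%:E +
    `|phase_min s' E0 - phase_min s'' E0|%:E)%E).
    by rewrite -EFinD lee_fin ler_distD.
  by apply: leeD; apply: ereal_sup_ubound; exists E, E0; apply: Or32.
- apply: (@le_trans _ _ (`|ln (mass s' E0 / mass s E0)|%:E +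
    `|ln (mass s'' E0 / mass s' E0)|%:E)%E).
    rewrite -EFinD lee_fin !ln_div ?posrE ?mass_gt0//.
    by rewrite [leRHS]addrC ler_distD.
  by apply: leeD; apply: ereal_sup_ubound; exists E, E0; apply: Or33.
Qed.

HB.instance Definition _ := gen_eqMixin (Stab R D).
HB.instance Definition _ := gen_choiceMixin (Stab R D).
HB.instance Definition _ := hasNbhs.Build (Stab R D) (nbhs_ (entourage_ stab_ball)).
HB.instance Definition _ := @Nbhs_isPseudoMetric.Build R (Stab R D)
  (entourage_ stab_ball) erefl stab_ball
  stab_ball_center stab_ball_sym stab_ball_triangle erefl.

End Mass.

(* Main.v *)
(* Fix sigma and let G_i be the HN factors of E for sigma, of phases phi_i.  If tau is
   close to sigma, the tau-phases of the HN factors of G_i are close to phi_i, so the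
   phases for distinct i do not overlap and the tau-HN filtrations of the G_i
   concatenate to the one of E.  Hence every weighted mass sum_j |Z(H_j)| g(psi_j)
   (over the HN factors H_j of phase psi_j) is, near sigma, additive over the G_i.
   On a single G_i it is m_tau(G_i) times a mean of values of g near phi_i, which
   converges to m_sigma(G_i) g(phi_i).

   The deformed mass is the case g(x) = exp(t x).  For the phase, put
   e(y) = (exp y - 1) / y, l(y) = ln(1 + y) / y, and let Q be the mean of x e(t x)
   with respect to the masses of the HN factors.  Then m^t / m = 1 + t Q, and
   phi^t = Q l(t Q) is continuous across t = 0. *)
Require Import Defs.
From mathcomp Require Import all_boot all_order all_algebra.
From mathcomp Require Import all_classical all_reals all_analysis.
Import numFieldNormedType.Exports.
From mathcomp Require Import complex lra.
Import Defs. (* again: MathComp's [vector] has shadowed [hom] *)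
Set Implicit Arguments.
Unset Strict Implicit.
Unset Printing Implicit Defensive.
Import Order.TTheory GRing.Theory Num.Theory.
Local Open Scope classical_set_scope.
Local Open Scope ring_scope.
Local Open Scope lincat_scope.

Lemma all_flatten (T : Type) (a : pred T) (ss : seq (seq T)) :
  all a (flatten ss) = all (all a) ss.
Proof. by elim: ss => //= s ss <-; rewrite all_cat. Qed.

(** * Linear categories: zero morphisms and isomorphisms *)

Section LinearCategories.
Context {k : fieldType} {C : linearCategory k}.
Implicit Types X Y Z : C.

Lemma comp0m X Y Z (f : hom X Y) : (0 : hom Y Z) ∘ f = 0.
Proof. by have := comp_linearl f (-1) (0 : hom Y Z) 0; rewrite /= scaler0 addr0 scaleN1r addNr. Qed.

Lemma compm0 X Y Z (f : hom Y Z) : f ∘ (0 : hom X Y) = 0.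
Proof. by have := comp_linearr f (-1) (0 : hom X Y) 0; rewrite /= scaler0 addr0 scaleN1r addNr. Qed.

Lemma compBm X Y Z (g g' : hom Y Z) (f : hom X Y) : (g - g') ∘ f = g ∘ f - g' ∘ f.
Proof. by have := comp_linearl f (-1) g' g; rewrite /= !scaleN1r ![- _ + _]addrC. Qed.

Lemma compmB X Y Z (g : hom Y Z) (f f' : hom X Y) : g ∘ (f - f') = g ∘ f - g ∘ f'.
Proof. by have := comp_linearr g (-1) f' f; rewrite /= !scaleN1r ![- _ + _]addrC. Qed.

Lemma compNm X Y Z (g : hom Y Z) (f : hom X Y) : (- g) ∘ f = - (g ∘ f).
Proof. by rewrite -sub0r compBm comp0m sub0r. Qed.

Lemma idm_iso X : is_iso (idm X).
Proof. by exists (idm X); rewrite comp1m. Qed.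

Lemma isomorphic_refl X : isomorphic X X.
Proof. by exists (idm X); exact: idm_iso. Qed.

Lemma isomorphic_sym X Y : isomorphic X Y -> isomorphic Y X.
Proof. by move=> [f [g [gf fg]]]; exists g; exists f. Qed.

Lemma is_zeroP X : is_zero X <-> idm X = 0.
Proof.
split=> [/(_ X)[h _]|id0 Y]; first exact: h.
by split=> f; [rewrite -[f]compm1 id0 compm0|rewrite -[f]comp1m id0 comp0m].
Qed.

Lemma is_zero_iso X Y : isomorphic X Y -> is_zero X -> is_zero Y.
Proof.
move=> [f [g [gf fg]]] /is_zeroP X0; apply/is_zeroP.
by rewrite -fg -[g]comp1m X0 comp0m compm0.
Qed.

End LinearCategories.

(** * Linear functors; equivalences are fully faithful *)

Section LinearFunctors.
Context {k : fieldType} {C D : linearCategory k} (F : linearFunctor C D).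

Lemma fmap0 (X Y : C) : fmap F (0 : hom X Y) = 0.
Proof. by have := fmap_linear F (-1) (0 : hom X Y) 0; rewrite /= scaler0 addr0 scaleN1r addNr. Qed.

Lemma is_zero_fob (X : C) : is_zero X -> is_zero (F X).
Proof. by move=> /is_zeroP X0; apply/is_zeroP; rewrite -fmap1 X0 fmap0. Qed.

Lemma fmap_inj_of_retract (G : linearFunctor D C) :
  naturally_isomorphic (comp_functor G F) (id_functor C) ->
  forall X Y : C, injective (@fmap _ _ _ F X Y).
Proof.
move=> [eta [nat iso]] X Y f g fg; have [e [_ eK]] := iso X.
have GFfg : fmap (comp_functor G F) f = fmap (comp_functor G F) g.
  by rewrite /= fg.
have := nat _ _ f; rewrite GFfg nat /= => /(congr1 (fun z => z ∘ e)).
by rewrite -!compA eK !compm1.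
Qed.

End LinearFunctors.

Section Equivalence.
Context {k : fieldType} {C D : linearCategory k} (F : linearFunctor C D).
Hypothesis FE : equivalence_of_categories F.

Lemma equivalence_fmap_inj (X Y : C) : injective (@fmap _ _ _ F X Y).
Proof. by have [G [GF _]] := FE; exact: fmap_inj_of_retract GF X Y. Qed.

Lemma equivalence_fmap_surj (X Y : C) (c : hom (F X) (F Y)) : exists b, fmap F b = c.
Proof.
have [G [GF FG]] := FE; have [eta [nat iso]] := GF.
have [e [eK Ke]] := iso X; have [e' [eK' Ke']] := iso Y.
(* Naturality of [eta] forces this preimage; [F] maps it to [c] because [G] is faithful too. *)
exists (eta Y ∘ fmap G c ∘ e); apply: (fmap_inj_of_retract FG).
have := nat _ _ (eta Y ∘ fmap G c ∘ e); rewrite /= -[RHS]compA eK compm1.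
by move/(congr1 (fun z => e' ∘ z)); rewrite !compA eK' !comp1m.
Qed.

End Equivalence.

(** * Lifting, factoring and cancelling along distinguished triangles *)

Section Triangles.
Context {k : fieldType} {D : triangulatedCategory k}.
Implicit Types X Y Z W N : D.

Lemma exists_zero : exists X : D, is_zero X.
Proof. by have [] := tcat_additive D. Qed.

Lemma shift_inj X Y : injective (@fmap _ _ _ (@tshift k D) X Y).
Proof. exact/equivalence_fmap_inj/shift_equivalence. Qed.

Lemma shift_surj X Y (c : hom (tshift X) (tshift Y)) : exists b, fmap tshift b = c.
Proof. exact/equivalence_fmap_surj/shift_equivalence. Qed.

(** TR3 maps the triangle to 0 -> W -> W, whose second map is an identity; the third component of
    this map is the factorisation. *)
Lemma dist_factor_cone X Y Z (f : hom X Y) (g : hom Y Z) (h : hom Z (tshift X))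
    W (a : hom Y W) :
  distinguished f g h -> a ∘ f = 0 -> exists b : hom Z W, b ∘ g = a.
Proof.
move=> fgh af0; have [N N0] := exists_zero.
have W0 : distinguished (0 : hom N W) (idm W) (0 : hom W (tshift N)).
  by apply/TR2; rewrite fmap0 oppr0; apply: TR1_id; exact: is_zero_fob.
have sq : a ∘ f = 0 ∘ (0 : hom X N) by rewrite af0 comp0m.
by have [c [cg _]] := TR3 fgh W0 sq; exists c; rewrite cg comp1m.
Qed.

Lemma dist_factor_fiber X Y Z (f : hom X Y) (g : hom Y Z) (h : hom Z (tshift X))
    W (a : hom W Y) :
  distinguished f g h -> g ∘ a = 0 -> exists b : hom W X, f ∘ b = a.
Proof.
move=> /TR2 fgh ga0; have [N N0] := exists_zero.
have W0 := (TR2 _ _ _).1 (TR1_id W N0).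
have sq : (0 : hom N Z) ∘ (0 : hom W N) = g ∘ a by rewrite ga0 comp0m.
have [c [_ ca]] := TR3 W0 fgh sq.
(* TR3 yields only a map of shifted objects; the shift is full and faithful, so it descends to W ->
   X. *)
have [b bc] := shift_surj c; exists b; apply: (@shift_inj W Y).
move: ca; rewrite fmap1 -bc compNm -fmap_comp -[- idm _]sub0r compmB compm0 compm1 sub0r.
by move/oppr_inj.
Qed.

(* The vanishing hypothesis replaces [Hom(W, Z[-1]) = 0], as no inverse shift is given. *)
Lemma dist_cancel X Y Z (f : hom X Y) (g : hom Y Z) (h : hom Z (tshift X))
    W (a a' : hom W X) :
  distinguished f g h -> (forall b : hom (tshift W) Z, b = 0) ->
  f ∘ a = f ∘ a' -> a = a'.
Proof.
move=> /TR2 /TR2 fgh WZ0 faa'; apply/subr0_eq/(@shift_inj W X); rewrite fmap0.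
have : (- fmap tshift f) ∘ fmap tshift (a - a') = 0.
  by rewrite compNm -fmap_comp compmB faa' subrr fmap0 oppr0.
by move=> /(dist_factor_fiber fgh)[b <-]; rewrite (WZ0 b) compm0.
Qed.

Lemma dist_cancel_cone X Y Z (f : hom X Y) (g : hom Y Z) (h : hom Z (tshift X))
    W (a a' : hom Z W) :
  distinguished f g h -> (forall b : hom (tshift X) W, b = 0) ->
  a ∘ g = a' ∘ g -> a = a'.
Proof.
move=> /TR2 fgh XW0 aa'g; apply/subr0_eq.
have : (a - a') ∘ g = 0 by rewrite compBm aa'g subrr.
by move=> /(dist_factor_cone fgh)[b <-]; rewrite (XW0 b) comp0m.
Qed.

(** Since X[1] is zero, the identity of Z lifts to a section u of g; then ug - 1 factors through X,
    hence vanishes. *)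
Lemma triangle_zero_iso X Y Z : is_zero X -> triangle X Y Z -> isomorphic Y Z.
Proof.
move=> X0 [f [g [h fgh]]].
have h0 : h ∘ idm Z = 0 by exact: (proj2 (is_zero_fob tshift X0 Z)).
have [u gu] := dist_factor_fiber ((TR2 _ _ _).1 fgh) h0.
have : g ∘ (u ∘ g - idm Y) = 0 by rewrite compmB compA gu comp1m compm1 subrr.
move=> /(dist_factor_fiber fgh)[b /esym ug].
exists g, u; split=> //; apply/subr0_eq; rewrite ug.
by rewrite (proj2 (X0 Y) b) compm0.
Qed.

Lemma triangle_iso_mid X Y Y' Z : isomorphic Y Y' -> triangle X Y Z -> triangle X Y' Z.
Proof.
move=> [u [v [vu uv]]] [f [g [h fgh]]]; exists (u ∘ f), (g ∘ v), h.
apply: (TR1_iso (a := idm X) (b := u) (c := idm Z) _ _ _ _ _ _ fgh).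
- exact: idm_iso.
- by exists v.
- exact: idm_iso.
- by rewrite compm1.
- by rewrite -compA vu compm1 comp1m.
- by rewrite fmap1 comp1m compm1.
Qed.

(** The triangle X -> Y -> 0 compares the classes, and 0 -> 0 -> 0 shows that a zero object has
    class 0. *)
Lemma K0_class_iso X Y : isomorphic X Y -> K0_class X = K0_class Y.
Proof.
move=> XY; have [N N0] := exists_zero.
have XO Z : triangle Z Z N.
  by exists (idm Z), (0 : hom Z N), (0 : hom N (tshift Z)); exact: TR1_id.
have classO : K0_class N = 0.
  by apply: (addrI (K0_class N)); rewrite addr0 -(K0_class_triangle (XO N)).
by rewrite (K0_class_triangle (triangle_iso_mid XY (XO X))) classO addr0.
Qed.

End Triangles.

(** * Harder-Narasimhan towers: concatenation, uniqueness, refinement *)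

Section Towers.
Context {R : realType} {k : fieldType} {D : triangulatedCategory k}.
Implicit Types (P : slicing R D) (l : seq (R * D)) (E G X Y Z : D) (phi psi : R).

(* [tower P l E]: [l] lists the phases and factors of a Harder-Narasimhan
   filtration of [E].  It is peeled off from the factor of largest phase, so that
   lists are concatenated by the octahedral axiom without desuspending. *)
Inductive tower P : seq (R * D) -> D -> Prop :=
| tower_nil E : is_zero E -> tower P [::] E
| tower_cons phi G l E E' : P phi G -> ~ is_zero G ->
    all (fun x => x.1 < phi) l -> triangle G E E' -> tower P l E' ->
    tower P ((phi, G) :: l) E.

Lemma tower_iso P l E E' : isomorphic E E' -> tower P l E -> tower P l E'.
Proof.
move=> EE' lE; case: lE EE' => [A A0 AE'|phi G m A B PG G0 lt GAB mB AE'].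
  by apply: tower_nil; exact: is_zero_iso AE' A0.
exact: tower_cons PG G0 lt (triangle_iso_mid AE' GAB) mB.
Qed.

(** Octahedral axiom on G -> X -> Y, with G the top factor of X and B its cone: the cone V of the
    composite sits in a triangle B -> V -> Z, to which induction applies. *)
Lemma tower_cat P l l' X Y Z : allrel (fun x y => y.1 < x.1) l l' ->
  triangle X Y Z -> tower P l X -> tower P l' Z -> tower P (l ++ l') Y.
Proof.
move=> + XYZ lX l'Z; elim: lX Y XYZ => [A A0|phi G m A B PG G0 lt GAB mB IH] Y XYZ.
  by move=> _; apply: (tower_iso _ l'Z); exact/isomorphic_sym/(triangle_zero_iso A0).
rewrite allrel_consl => /andP[ltl' mrel].
have [f [j [d fjd]]] := GAB; have [g [m' [n gmn]]] := XYZ.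
have [V [l0 [e gfle]]] := TR1_cone (g ∘ f).
have [u [v [uv _ _ _ _]]] := TR4 fjd gfle gmn.
apply: (tower_cons (E' := V) PG G0).
- by rewrite all_cat lt.
- by exists (g ∘ f), l0, e.
- by apply: IH mrel; exists u, v, (fmap tshift j ∘ n).
Qed.

Lemma tower1 P phi G : P phi G -> ~ is_zero G -> tower P [:: (phi, G)] G.
Proof.
move=> PG G0; have [N N0] := @exists_zero _ D.
apply: (@tower_cons _ _ _ _ _ N) => //; last exact: tower_nil.
by exists (idm G), (0 : hom G N), (0 : hom N (tshift G)); exact: TR1_id.
Qed.

(** The map dies in the lower part of E by induction, so it lifts to the top factor, where
    orthogonality of slices kills it. *)
Lemma tower_hom0 P l E G phi (a : hom G E) :
  P phi G -> all (fun x => x.1 < phi) l -> tower P l E -> a = 0.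
Proof.
move=> PG + lE; elim: lE a => [A A0 a _|psi H m A B PH H0 _ [f [g [h fgh]]] _ IH a /=].
  exact: (proj2 (A0 G)).
move=> /andP[psi_phi /IH mB]; have [b <-] := dist_factor_fiber fgh (mB (g ∘ a)).
by rewrite (slice_hom0 psi_phi PG PH b) compm0.
Qed.

Lemma slice_tshift P phi G : P phi G -> P (phi + 1) (tshift G).
Proof. by move=> PG; apply/slice_shift; exists G; split=> //; exact: isomorphic_refl. Qed.

(** Provides the vanishing hypotheses of [dist_cancel] and [dist_cancel_cone]: shifting only raises
    the phase. *)
Lemma tower_shift_hom0 P l E G phi (a : hom (tshift G) E) :
  P phi G -> all (fun x => x.1 < phi) l -> tower P l E -> a = 0.
Proof.
move=> /slice_tshift PG ltl; apply: tower_hom0 PG _; apply: sub_all ltl => x /lt_trans.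
by apply; rewrite ltrDl.
Qed.

(** If psi < phi, the map G -> E vanishes: it is zero towards E'', so it lifts to H, where it is
    zero as well. But maps from G cancel along G -> E, so G would be zero. *)
Lemma tower_phase_le P phi psi G H l m E E' E'' :
  P phi G -> ~ is_zero G -> all (fun x => x.1 < phi) l -> triangle G E E' ->
  tower P l E' ->
  P psi H -> all (fun x => x.1 < psi) m -> triangle H E E'' -> tower P m E'' ->
  phi <= psi.
Proof.
move=> PG G0 ltl [f [g [h fgh]]] lE' PH ltm [f' [g' [h' fgh']]] mE''.
rewrite leNgt; apply/negP => psi_phi; apply: G0; apply/is_zeroP.
have f0 : f = 0.
  have g'f : g' ∘ f = 0.
    apply: tower_hom0 PG _ mE''; apply: sub_all ltm => x /lt_trans; exact.
  have [b <-] := dist_factor_fiber fgh' g'f.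
  by rewrite (slice_hom0 psi_phi PG PH b) compm0.
apply: (dist_cancel (a' := 0) fgh); last by rewrite f0 !comp0m.
by move=> b; apply: tower_shift_hom0 PG ltl lE'.
Qed.

(** The top factors have equal phase and lift through each other, which makes the cones isomorphic
    too. Phases and classes in K0 are all that masses depend on. *)
Lemma tower_uniq P l l' E E' : isomorphic E E' -> tower P l E -> tower P l' E' ->
  [seq (x.1, K0_class x.2) | x <- l] = [seq (x.1, K0_class x.2) | x <- l'].
Proof.
move=> EE' lE l'E'; have {E' EE' l'E'} := tower_iso (isomorphic_sym EE') l'E'.
(* A zero object has only the empty tower: a top factor would map to it by a cancellable map. *)
have top0 phi G X Y m : P phi G -> ~ is_zero G -> all (fun x => x.1 < phi) m ->
    triangle G X Y -> tower P m Y -> is_zero X -> False.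
  move=> PG G0 ltm [f [g [h fgh]]] mY X0; apply: G0; apply/is_zeroP.
  apply: (dist_cancel (a' := 0) fgh); last exact: etrans (proj2 (X0 G) _) (esym (proj2 (X0 G) _)).
  by move=> b; apply: tower_shift_hom0 PG ltm mY.
elim: lE l' => [A A0|phi G m A B PG G0 ltm GAB mB IH] l' l'A.
  case: l'A A0 => // phi G m X Y PG G0 ltm GXY mY X0.
  by case: (top0 _ _ _ _ _ PG G0 ltm GXY mY X0).
case: l'A GAB => [X X0 GXB|psi H n X Y PH H0 ltn HXY nY GXB].
  by case: (top0 _ _ _ _ _ PG G0 ltm GXB mB X0).
have phi_psi : phi = psi.
  apply/eqP; rewrite eq_le (tower_phase_le PG G0 ltm GXB mB PH ltn HXY nY).
  by rewrite (tower_phase_le PH H0 ltn HXY nY PG ltm GXB mB).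
move: PH ltn; rewrite -phi_psi => PH ltn {phi_psi psi}.
have [f [g [h fgh]]] := GXB; have [f' [g' [h' fgh']]] := HXY.
have [u f'u] := dist_factor_fiber fgh' (tower_hom0 (g' ∘ f) PG ltn nY).
have [v fv] := dist_factor_fiber fgh (tower_hom0 (g ∘ f') PH ltm mB).
have GH : isomorphic G H.
  exists u, v; split.
    apply: (dist_cancel fgh) => [b|]; first exact: tower_shift_hom0 PG ltm mB.
    by rewrite compA fv f'u compm1.
  apply: (dist_cancel fgh') => [b|]; first exact: tower_shift_hom0 PH ltn nY.
  by rewrite compA f'u fv compm1.
have [a ag] : exists a : hom B Y, a ∘ g = g'.
  by apply: (dist_factor_cone fgh); apply: tower_hom0 PG ltn nY.
have [b bg'] : exists b : hom Y B, b ∘ g' = g.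
  by apply: (dist_factor_cone fgh'); apply: tower_hom0 PH ltm mB.
have BY : isomorphic Y B.
  exists b, a; split.
    apply: (dist_cancel_cone fgh') => [c|]; first exact: tower_shift_hom0 PH ltn nY.
    by rewrite -compA bg' ag comp1m.
  apply: (dist_cancel_cone fgh) => [c|]; first exact: tower_shift_hom0 PG ltm mB.
  by rewrite -compA ag bg' comp1m.
by rewrite /= (K0_class_iso GH) (IH _ (tower_iso BY nY)).
Qed.

(** Induction along the filtration, gluing the tower of each new factor below the earlier ones.
    [Q = P] with one-term lists turns an HN filtration into a tower; a nearby slicing [Q] gives the
    refinement used for continuity. *)
Lemma tower_refine (P Q : slicing R D) E (F : HN_filtration P E)
    (ls : nat -> seq (R * D)) :
  (forall i, (i < hn_length F)%N -> tower Q (ls i) (hn_factor F i)) ->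
  (forall i j, (i < j < hn_length F)%N ->
    allrel (fun x y => y.1 < x.1) (ls i) (ls j)) ->
  tower Q (flatten [seq ls i | i <- index_iota 0 (hn_length F)]) E.
Proof.
move=> lsG lsrel; rewrite /index_iota subn0 -[E in tower _ _ E](hn_obn F).
have [n nF] : {n | n = hn_length F} by exists (hn_length F).
rewrite -nF; have : (n <= hn_length F)%N by rewrite nF.
elim: n {nF} => [_|n IH nF]; first exact/tower_nil/hn_ob0.
rewrite -addn1 iotaD map_cat flatten_cat /= cats0 add0n addn1.
apply: tower_cat (hn_triangle nF) (IH (ltnW nF)) (lsG _ nF).
rewrite /allrel all_flatten all_map; apply/allP => i; rewrite mem_iota /= => lin.
by apply: lsrel; rewrite lin.
Qed.

Definition hn_seq P E (F : HN_filtration P E) : seq (R * D) :=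
  [seq (hn_phase F i, hn_factor F i) | i <- index_iota 0 (hn_length F)].

Lemma tower_hn_seq P E (F : HN_filtration P E) : tower P (hn_seq F) E.
Proof.
rewrite /hn_seq -flatten_map1; apply: tower_refine => [i lin|i j ij].
  by apply: tower1; [exact: hn_factorP|exact: hn_factor_neq0].
by rewrite /allrel /= (hn_phase_decr ij).
Qed.

End Towers.

(** * Weighted masses and their continuity *)

Section Masses.
Context {R : realType} {k : fieldType} {D : triangulatedCategory k}.
Implicit Types (s : Stab R D) (l : seq (R * D)) (E G X Y Z : D) (phi psi : R).
Implicit Types (g : R -> R).

(** Totalised by the empty list on zero objects, so that sums carry no proof of nonvanishing. *)
Definition hn_list s E : seq (R * D) :=
  if pselect (~ is_zero E) is left E0 then hn_seq (HN s E0) else [::].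

Lemma hn_listE s E (E0 : ~ is_zero E) : hn_list s E = hn_seq (HN s E0).
Proof.
by rewrite /hn_list; case: pselect => // E0'; rewrite (Prop_irrelevance E0' E0).
Qed.

Lemma tower_hn_list s E : tower s (hn_list s E) E.
Proof.
rewrite /hn_list; case: pselect => [E0|/notP E0]; last exact: tower_nil.
exact: tower_hn_seq.
Qed.

Definition weight s g l : R :=
  \sum_(x <- l) Normc.normc (central_charge s (K0_class x.2)) * g x.1.

Definition gmass s g E : R := weight s g (hn_list s E).

Lemma weightE s g l : weight s g l =
  \sum_(x <- [seq (x.1, K0_class x.2) | x <- l]) Normc.normc (central_charge s x.2) * g x.1.
Proof. by rewrite big_map. Qed.

Lemma gmass_tower s g l E : tower s l E -> gmass s g E = weight s g l.
Proof.
move=> lE; rewrite /gmass !weightE.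
by rewrite (tower_uniq (isomorphic_refl E) (tower_hn_list s E) lE).
Qed.

Lemma gmassE s g E (E0 : ~ is_zero E) :
  gmass s g E = \sum_(i < hn_length (HN s E0)) factor_mass s E0 i * g (hn_phase (HN s E0) i).
Proof. by rewrite /gmass hn_listE /weight big_map big_mkord. Qed.

Lemma tmassE t s E (E0 : ~ is_zero E) : tmass t s E0 = gmass s (fun x => expR (t * x)) E.
Proof. by rewrite gmassE. Qed.

Lemma massE s E (E0 : ~ is_zero E) : mass s E0 = gmass s (fun=> 1) E.
Proof.
by rewrite /mass tmassE; congr gmass; apply/funext => x; rewrite mul0r expR0.
Qed.

Lemma hn_list_phase s E (E0 : ~ is_zero E) :
  all (fun x => phase_min s E0 <= x.1 <= phase_max s E0) (hn_list s E).
Proof.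
have decr i j : (i <= j < hn_length (HN s E0))%N ->
    hn_phase (HN s E0) j <= hn_phase (HN s E0) i.
  rewrite leq_eqVlt => /andP[/predU1P[->//|ij] jn].
  by apply/ltW/hn_phase_decr; rewrite ij.
rewrite (hn_listE s E0) all_map; apply/allP => i; rewrite mem_index_iota /= => iln.
rewrite /phase_min /phase_max !decr ?iln// -ltnS prednK; last exact: leq_trans iln.
by rewrite iln leqnn.
Qed.

Lemma hn_list_slice s phi G : s phi G -> ~ is_zero G ->
  [seq (x.1, K0_class x.2) | x <- hn_list s G] = [:: (phi, K0_class G)].
Proof.
move=> sG G0.
exact: (tower_uniq (isomorphic_refl G) (tower_hn_list s G) (tower1 sG G0)).
Qed.

Lemma phase_slice s phi G (G0 : ~ is_zero G) : s phi G ->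
  phase_max s G0 = phi /\ phase_min s G0 = phi.
Proof.
move=> /hn_list_slice/(_ G0); rewrite (hn_listE s G0) /hn_seq -map_comp.
rewrite /phase_max /phase_min; case: (HN s G0) => -[|[|n]] //= ob fac ph _ _ _ _ _ _.
by move=> [->].
Qed.

Lemma gmass_slice s g phi G : s phi G -> ~ is_zero G ->
  gmass s g G = Normc.normc (central_charge s (K0_class G)) * g phi.
Proof. by move=> sG G0; rewrite (gmass_tower g (tower1 sG G0)) /weight big_seq1. Qed.

(** The concatenated lists form a tower of E for [s'], and [gmass] can be computed on any tower. *)
Lemma gmass_refine s s' g E (E0 : ~ is_zero E) (F := HN s E0) :
  (forall i j, (i < j < hn_length F)%N -> allrel (fun x y => y.1 < x.1)
    (hn_list s' (hn_factor F i)) (hn_list s' (hn_factor F j))) ->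
  gmass s' g E = \sum_(i < hn_length F) gmass s' g (hn_factor F i).
Proof.
move=> lsrel; rewrite (gmass_tower g (tower_refine _ lsrel)); last first.
  by move=> i _; exact: tower_hn_list.
by rewrite /weight big_flatten /= big_map big_mkord.
Qed.

(** The mass is the sum of the same nonnegative weights, so the quotient is a weighted mean of
    values of [g]. *)
Lemma gmass_mean s g E (E0 : ~ is_zero E) (c e : R) :
  all (fun x => `|c - g x.1| <= e) (hn_list s E) ->
  `|c - gmass s g E / mass s E0| <= e.
Proof.
move=> ge; have m0 := mass_gt0 s E0.
rewrite -[c in `|c - _|](mulfK (lt0r_neq0 m0)) -mulrBl normrM (gtr0_norm (x := _^-1)) ?invr_gt0//.
rewrite ler_pdivrMr// massE /gmass /weight !mulr_sumr -sumrB.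
apply: le_trans (ler_norm_sum _ _ _) _.
elim: (hn_list s E) ge => [_|x l IH /= /andP[xe /IH le]]; first by rewrite !big_nil.
rewrite !big_cons; apply: lerD le; rewrite mulr1 mulrC -mulrBr normrM mulrC.
have n0 : 0 <= Normc.normc (central_charge s (K0_class x.2)).
  by case: (central_charge s _) => a b; exact: sqrtr_ge0.
by rewrite (ger0_norm n0) ler_wpM2r.
Qed.

Lemma stab_ball_dist s s' (e : R) E (E0 : ~ is_zero E) : ball s e s' ->
  [/\ `|phase_max s E0 - phase_max s' E0| < e,
      `|phase_min s E0 - phase_min s' E0| < e
    & `|ln (mass s' E0 / mass s E0)| < e].
Proof.
move=> ss'; have bd x : (x%:E <= stab_dist s s')%E -> x < e.
  by move=> /le_lt_trans/(_ ss'); rewrite lte_fin.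
split; apply: bd; apply: ereal_sup_ubound; exists E, E0.
- exact: Or31.
- exact: Or32.
- exact: Or33.
Qed.

(** Both extreme phases of a semistable object equal phi, and the metric moves each by less than
    e. *)
Lemma hn_list_ball s s' phi G (e : R) : s phi G -> ~ is_zero G -> ball s e s' ->
  all (fun x => `|phi - x.1| < e) (hn_list s' G).
Proof.
move=> sG G0 /(stab_ball_dist G0)[dmax dmin _].
have [smax smin] := phase_slice G0 sG; move: dmax dmin; rewrite smax smin.
rewrite !ltr_distl => /andP[lmax _] /andP[_ lmin].
apply: sub_all (hn_list_phase s' G0) => x /andP[xmin xmax].
rewrite ltr_distl (le_lt_trans _ lmax) ?lerD2r//=.
by apply: (lt_le_trans lmin); rewrite lerD2r.
Qed.

Lemma mass_continuous E (E0 : ~ is_zero E) : continuous (fun s => mass s E0).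
Proof.
move=> s; have m0 := mass_gt0 s E0.
(* The metric controls the mass only through the logarithm of a ratio. *)
have -> : (fun s' => mass s' E0) =
    (fun s' => mass s E0 * expR (ln (mass s' E0 / mass s E0))).
  apply/funext => s'; rewrite lnK ?posrE ?divr_gt0 ?mass_gt0//.
  by rewrite mulrCA divff ?mulr1 // lt0r_neq0.
rewrite /continuous_at divff ?lt0r_neq0// ln1.
apply: (@cvgM _ _ (nbhs s)); first exact: cvg_cst.
apply: (@continuous_cvg _ _ _ (nbhs s) _ _ expR); first exact: continuous_expR.
apply/cvgrPdist_lt => e e0; near=> s'.
rewrite sub0r normrN.
have : ball s e s' by near: s'; exact: nbhsx_ballx.
by case/(stab_ball_dist E0).
Unshelve. all: by end_near. Qed.

Lemma gmass_slice_cvg (h : R * R -> R) s t phi G : continuous h ->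
  s phi G -> ~ is_zero G ->
  gmass p.2 (fun x => h (p.1, x)) G @[p --> (t, s)] --> gmass s (fun x => h (t, x)) G.
Proof.
move=> hc sG G0.
have -> : (fun p : R * Stab R D => gmass p.2 (fun x => h (p.1, x)) G) =
    (fun p => mass p.2 G0 * (gmass p.2 (fun x => h (p.1, x)) G / mass p.2 G0)).
  by apply/funext => p; rewrite mulrCA divff ?mulr1// lt0r_neq0// mass_gt0.
have -> : gmass s (fun x => h (t, x)) G = mass s G0 * h (t, phi).
  by rewrite massE !(gmass_slice _ sG G0) mulr1.
apply: cvgM.
  apply: (@continuous_cvg _ _ _ (nbhs (t, s)) _ snd (fun s => mass s G0)).
    exact: mass_continuous.
  exact: cvg_snd.
apply/cvgrPdist_le => e e0.
have /cvgrPdist_le/(_ e e0) := hc (t, phi).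
(* One d serves twice: it bounds the change of t and, through the metric, the distance of the new
   phases from phi. *)
move=> /nbhs_ballP[d /= d0 hd].
have : \forall p \near (t, s), ball (t, s) d p by exact: nbhsx_ballx.
apply: filterS => p [tp sp].
by apply: gmass_mean; apply: sub_all (hn_list_ball sG G0 sp) => x xd; exact: hd.
Qed.

Lemma near_hn_list_allrel s phi psi G H : s phi G -> s psi H ->
  ~ is_zero G -> ~ is_zero H -> psi < phi ->
  \forall s' \near s, allrel (fun x y => y.1 < x.1) (hn_list s' G) (hn_list s' H).
Proof.
move=> sG sH G0 H0 psi_phi.
(* Half the gap keeps the two sets of phases on either side of the midpoint. *)
have d0 : 0 < (phi - psi) / 2 by rewrite divr_gt0// subr_gt0.
near=> s'.
have ss' : ball s ((phi - psi) / 2) s' by near: s'; exact: nbhsx_ballx.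
apply: sub_all (hn_list_ball sG G0 ss') => x xphi.
apply: sub_all (hn_list_ball sH H0 ss') => y ypsi.
move: xphi ypsi; rewrite !ltr_distl; lra.
Unshelve. all: by end_near. Qed.

Lemma gmass_continuous (h : R * R -> R) E : continuous h -> ~ is_zero E ->
  continuous (fun p : R * Stab R D => gmass p.2 (fun x => h (p.1, x)) E).
Proof.
move=> hc E0 [t s] /=; pose F := HN s E0.
have FS i : (i < hn_length F)%N -> s (hn_phase F i) (hn_factor F i) /\ ~ is_zero (hn_factor F i).
  by move=> lin; split; [exact: hn_factorP|exact: hn_factor_neq0].
(* One neighbourhood serves all g, since the weight h(t, -) varies with t. *)
have refine : \forall s' \near s, forall g,
    gmass s' g E = \sum_(i < hn_length F) gmass s' g (hn_factor F i).
  (* Finitely many pairs of factors, so their neighbourhoods intersect in one. *)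
  have : \forall s' \near s, forall ij : 'I_(hn_length F) * 'I_(hn_length F), (ij.1 < ij.2)%N ->
    allrel (fun x y => y.1 < x.1)
      (hn_list s' (hn_factor F ij.1)) (hn_list s' (hn_factor F ij.2)).
    apply: (@filter_forall _ _ _ (nbhs s)) => -[i j] /=.
    have [ij|_] := boolP (i < j)%N; last by near=> s'.
    have [[sGi Gi0] [sGj Gj0]] := (FS _ (ltn_ord i), FS _ (ltn_ord j)).
    have ji : hn_phase F j < hn_phase F i by apply: hn_phase_decr; rewrite ij ltn_ord.
    by apply: filterS (near_hn_list_allrel sGi sGj Gi0 Gj0 ji) => s' ? _.
  apply: filterS => s' rel g; apply: gmass_refine => i j /andP[ij jn].
  exact: (rel (Ordinal (ltn_trans ij jn), Ordinal jn)).
(* Additivity at [s] itself rewrites the limit. *)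
rewrite /continuous_at /= (nbhs_singleton refine).
have near_sum : \forall p \near (t, s),
    \sum_(i < hn_length F) gmass p.2 (fun x => h (p.1, x)) (hn_factor F i) =
    gmass p.2 (fun x => h (p.1, x)) E.
  have refine2 : \forall p \near (t, s), forall g,
      gmass p.2 g E = \sum_(i < hn_length F) gmass p.2 g (hn_factor F i).
    exact: (@cvg_snd _ _ (nbhs t) (nbhs s) _ _ refine).
  by apply: filterS refine2 => p ->.
apply: cvg_trans (near_eq_cvg near_sum) _.
apply: (@cvg_big R _ +%R 0 xpredT _ _ (nbhs (t, s))) => [|i _].
  exact: add_continuous.
have [sG G0] := FS _ (ltn_ord i).
exact: (@gmass_slice_cvg h s t _ _ hc sG G0).
Unshelve. all: by end_near. Qed.

End Masses.

(** * Divided differences with the singularity removed *)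

Section DividedDifference.
Context {R : realType}.
Implicit Types (f : R -> R) (a df y : R).

(* [(f(a + y) - f(a)) / y], extended to [y = 0] by the derivative [df]. *)
Definition divdiff f a df y : R := if y == 0 then df else y^-1 * (f (a + y) - f a).

Lemma mul_divdiff f a df y : y * divdiff f a df y = f (a + y) - f a.
Proof.
rewrite /divdiff; case: eqVneq => [->|y0]; first by rewrite mul0r addr0 subrr.
by rewrite mulrA divff// mul1r.
Qed.

Lemma divdiff_continuous f a df y : is_derive a 1 f df ->
  {for a + y, continuous f} -> {for y, continuous (divdiff f a df)}.
Proof.
move=> fa fc; have [->|y0] := eqVneq y 0.
  (* At y = 0 this is the convergence defining the derivative; elsewhere the function is locally a
     plain quotient. *)
  apply/continuous_withinNx; rewrite {2}/divdiff eqxx.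
  have [dfa <-] := fa; apply: cvg_trans dfa; apply: near_eq_cvg; near=> h.
  have h0 : h != 0 by near: h; exact: nbhs_dnbhs_neq.
  by rewrite /divdiff (negbTE h0) /= /GRing.scale /= mulr1 [h + a]addrC.
have near_neq0 : \forall z \near y, z^-1 * (f (a + z) - f a) = divdiff f a df z.
  near=> z; have z0 : z != 0 by near: z; exact: (@cvgr_neq0 R R R (nbhs y) _ id y cvg_id y0).
  by rewrite /divdiff (negbTE z0).
suff dfy : divdiff f a df z @[z --> y] --> y^-1 * (f (a + y) - f a).
  by move: dfy; rewrite (nbhs_singleton near_neq0).
apply: cvg_trans (near_eq_cvg near_neq0) _; apply: (@cvgM _ _ (nbhs y)).
  exact: cvgV.
apply: (@cvgB _ _ _ (nbhs y)); last exact: cvg_cst.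
apply: (@continuous_cvg _ _ _ (nbhs y) _ (fun z => a + z) f) => //.
by apply: (@cvgD _ _ _ (nbhs y)); [exact: cvg_cst|exact: cvg_id].
Unshelve. all: by end_near. Qed.

End DividedDifference.

(** * Continuity of the deformed mass and phase *)

Section Continuity.
Context {R : realType} {k : fieldType} {D : triangulatedCategory k}.
Implicit Types (s : Stab R D) (E : D) (g : R -> R).

Lemma gmass_affine s g E (t : R) :
  gmass s (fun x => 1 + t * g x) E = gmass s (fun=> 1) E + t * gmass s g E.
Proof.
rewrite /gmass /weight mulr_sumr -big_split; apply: eq_bigr => x _ /=.
by rewrite mulrDr mulrCA.
Qed.

(** A summand positive at t = 0 is positive at every t, exponentials being positive. *)
Lemma tmass_gt0 t s E (E0 : ~ is_zero E) : 0 < tmass t s E0.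
Proof.
have n0 i : 0 <= factor_mass s E0 i.
  by rewrite /factor_mass; case: (central_charge s _) => a b; exact: sqrtr_ge0.
have := mass_gt0 s E0; rewrite /mass /tmass !lt0r !psumr_neq0; last 2 first.
- by move=> i _; rewrite mulr_ge0 ?expR_ge0.
- by move=> i _; rewrite mulr_ge0 ?expR_ge0.
move=> /andP[pos _]; rewrite sumr_ge0 ?andbT => [|i _]; last by rewrite mulr_ge0 ?expR_ge0.
by apply: sub_has pos => i; rewrite !pmulr_lgt0 ?expR_gt0.
Qed.

(** [expdd] and [lndd] are the functions e and l, both with value 1 at 0; [tmean] is Q. *)
Let expdd : R -> R := divdiff expR 0 1.
Let lndd : R -> R := divdiff (@ln R) 1 1.

Let tmean s (t : R) E (E0 : ~ is_zero E) : R := gmass s (fun x => x * expdd (t * x)) E / mass s E0.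

(** Sum exp(t x) = 1 + t x e(t x) against the masses of the factors. *)
Lemma tmass_tmean s t E (E0 : ~ is_zero E) : tmass t s E0 / mass s E0 = 1 + t * tmean s t E0.
Proof.
have -> : tmass t s E0 = gmass s (fun x => 1 + t * (x * expdd (t * x))) E.
  rewrite tmassE; congr gmass; apply/funext => x.
  by rewrite mulrA mul_divdiff add0r expR0 addrC subrK.
by rewrite gmass_affine -massE mulrDl divff ?lt0r_neq0 ?mass_gt0// mulrA.
Qed.

Lemma tphase_tmean s t E (E0 : ~ is_zero E) :
  tphase t s E0 = tmean s t E0 * lndd (t * tmean s t E0).
Proof.
rewrite /tphase; case: eqVneq => [->|t0].
  (* At t = 0 both divided differences equal 1, leaving the mean phase. *)
  rewrite mul0r /lndd /divdiff eqxx mulr1 /tmean mulrC gmassE; congr (_ / _).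
  by apply: eq_bigr => i _; rewrite mul0r /expdd /divdiff eqxx mulr1.
apply: (mulfI t0); rewrite mulrA divff// mul1r mulrA mul_divdiff.
by rewrite ln1 subr0 tmass_tmean.
Qed.

Lemma expdd_continuous : continuous expdd.
Proof.
move=> y; apply: divdiff_continuous; last exact: continuous_expR.
by have := is_derive_expR (0 : R); rewrite expR0.
Qed.

Lemma tmean_continuous E (E0 : ~ is_zero E) :
  continuous (fun p : R * Stab R D => tmean p.2 p.1 E0).
Proof.
move=> p; apply: (@cvgM _ _ (nbhs p)).
  apply: (gmass_continuous (h := fun z => z.2 * expdd (z.1 * z.2))) E0 _ => z.
  apply: (@cvgM _ _ (nbhs z)); first exact: cvg_snd.
  apply: (@continuous_cvg _ _ _ (nbhs z) _ _ expdd); first exact: expdd_continuous.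
  by apply: (@cvgM _ _ (nbhs z)); [exact: cvg_fst|exact: cvg_snd].
apply: (@cvgV _ _ (nbhs p)); first by rewrite lt0r_neq0 ?mass_gt0.
apply: (@continuous_cvg _ _ _ (nbhs p) _ snd (fun s => mass s E0)); last exact: cvg_snd.
exact: mass_continuous.
Qed.

Lemma tmass_continuous E (E0 : ~ is_zero E) :
  continuous (fun p : R * Stab R D => tmass p.1 p.2 E0).
Proof.
have -> : (fun p : R * Stab R D => tmass p.1 p.2 E0) =
    (fun p => gmass p.2 (fun x => expR (p.1 * x)) E).
  by apply/funext => p; exact: tmassE.
apply: (gmass_continuous (h := fun z => expR (z.1 * z.2))) E0 => z.
apply: (@continuous_cvg _ _ _ (nbhs z) _ _ expR); first exact: continuous_expR.
by apply: (@cvgM _ _ (nbhs z)); [exact: cvg_fst|exact: cvg_snd].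
Qed.

Lemma tphase_continuous E (E0 : ~ is_zero E) :
  continuous (fun p : R * Stab R D => tphase p.1 p.2 E0).
Proof.
have -> : (fun p : R * Stab R D => tphase p.1 p.2 E0) =
    (fun p => tmean p.2 p.1 E0 * lndd (p.1 * tmean p.2 p.1 E0)).
  by apply/funext => p; exact: tphase_tmean.
move=> p; apply: (@cvgM _ _ (nbhs p)); first exact: tmean_continuous.
apply: (@continuous_cvg _ _ _ (nbhs p) _ _ lndd).
  apply: divdiff_continuous.
    by have := @is_derive1_ln R _ ltr01; rewrite invr1.
  (* Here 1 + t Q is m^t / m, hence positive, so ln is continuous there. *)
  by apply: continuous_ln; rewrite -tmass_tmean divr_gt0 ?tmass_gt0 ?mass_gt0.
by apply: (@cvgM _ _ (nbhs p)); [exact: cvg_fst|exact: tmean_continuous].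
Qed.

End Continuity.

Theorem corollary3p4 (R : realType) (k : fieldType) (D : triangulatedCategory k)
    (E : D) (E0 : ~ is_zero E) :
  continuous (fun p : R * Stab R D => tmass p.1 p.2 E0) /\
  continuous (fun p : R * Stab R D => tphase p.1 p.2 E0).
Proof. by split; [exact: tmass_continuous|exact: tphase_continuous]. Qed.
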